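(* Let $V\subset\{1,\dots,15\}$ be a seven-element set of indices such that $m\oplus n\in V$ for all distinct $m,n\in V$. Then $V$ is flowmorphic to the Octonion index set $\{1,\dots,7\}$ if and only if $V$ harbors no zero-divisors. The flowmorphic ones are $\{1,\dots,7\}$ itself and the seven sets $V$ with $8\in V$. Furthermore, for a set $V$ that harbors zero-divisors, no replacement of some of the units $i_n$, $n\in V$, by their negatives makes $V$ flowmorphic to the Octonion index set.
   Context: The Sedenions are the 16-dimensional real (non-associative, distributive) algebra with basis $1,i_1,\dots,i_{15}$, where $1$ is the unit, $i_n^2=-1$, $i_mi_n=-i_ni_m$ for $m\ne n$, and for each triplet $(a,b,c)$ in the following list $i_ai_b=i_c$, $i_bi_c=i_a$, $i_ci_a=i_b$. O-trips: (1,2,3),(1,4,5),(1,7,6),(2,4,6),(2,5,7),(3,4,7),(3,6,5). S-trips: (1,8,9),(1,11,10),(1,13,12),(1,14,15),(2,8,10),(2,9,11),(2,14,12),(2,15,13),(3,8,11),(3,10,9),(3,15,12),(3,13,14),(4,8,12),(4,9,13),(4,10,14),(4,11,15),(5,8,13),(5,12,9),(5,10,15),(5,14,11),(6,8,14),(6,15,9),(6,12,10),(6,11,13),(7,8,15),(7,9,14),(7,13,10),(7,12,11). Thus $i_mi_n=\pm i_{m\oplus n}$, where $\oplus$ is bitwise XOR. A seven-element XOR-closed set $V$ carries the structure of a Fano plane whose lines are the triples $\{m,n,m\oplus n\}$; each line is cyclically oriented by the multiplication (the cyclic order $(a,b,c)$ with $i_ai_b=i_c$). $V$ is flowmorphic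 to $\{1,\dots,7\}$ if there is a bijection $\{1,\dots,7\}\to V$ carrying each of the seven cyclically oriented O-trips to an oriented line of $V$ with the same orientation. When some units $i_n$ are replaced by their negatives, the orientations are recomputed using the new units. $V$ harbors zero-divisors if there are distinct $A,B\in V$ and distinct $C,D\in V$ and signs $s,t\in\{\pm1\}$ with $(i_A+s\,i_B)(i_C+t\,i_D)=0$. *)

(* Defs.v *)
From HB Require Import structures.
From mathcomp Require Import all_boot all_order all_algebra.
From mathcomp Require Import reals.

Set Implicit Arguments.
Unset Strict Implicit.
Unset Printing Implicit Defensive.

Import Order.TTheory GRing.Theory Num.Theory.
Local Open Scope ring_scope.

Definition Otrips : seq (nat * nat * nat) :=
  [:: (1, 2, 3); (1, 4, 5); (1, 7, 6); (2, 4, 6); (2, 5, 7); (3, 4, 7);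
      (3, 6, 5)]%N.

Definition Strips : seq (nat * nat * nat) :=
  [:: (1, 8, 9); (1, 11, 10); (1, 13, 12); (1, 14, 15);
      (2, 8, 10); (2, 9, 11); (2, 14, 12); (2, 15, 13);
      (3, 8, 11); (3, 10, 9); (3, 15, 12); (3, 13, 14);
      (4, 8, 12); (4, 9, 13); (4, 10, 14); (4, 11, 15);
      (5, 8, 13); (5, 12, 9); (5, 10, 15); (5, 14, 11);
      (6, 8, 14); (6, 15, 9); (6, 12, 10); (6, 11, 13);
      (7, 8, 15); (7, 9, 14); (7, 13, 10); (7, 12, 11)]%N.

(* (a, b, c) is a cyclic rotation of a listed triplet. *)
Definition is_trip (a b c : nat) : bool :=
  let T := Otrips ++ Strips in
  [|| (a, b, c) \in T, (b, c, a) \in T | (c, a, b) \in T].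

(* Structure constants: the coefficient of i_k in i_m i_n, where i_0 is the
   unit 1. *)
Definition sed_coef (R : realType) (m n k : 'I_16) : R :=
  if m == ord0 then (k == n)%:R
  else if n == ord0 then (k == m)%:R
  else if m == n then - (k == ord0)%:R
  else if is_trip m n k then 1
  else if is_trip n m k then -1
  else 0.

(* The Sedenions are the real vector space 'rV[R]_16 with this product; index 0
   carries the coordinate along 1 and index n the coordinate along i_n. *)
Definition sed_mul (R : realType) (x y : 'rV[R]_16) : 'rV[R]_16 :=
  \row_k \sum_m \sum_n sed_coef R m n k * (x 0 m * y 0 n).

Definition sed_unit (R : realType) (n : 'I_16) : 'rV[R]_16 := delta_mx 0 n.

(* The units after replacing i_n by - i_n for every n in N. *)
Definition neg_units (R : realType) (N : {set 'I_16}) (n : 'I_16) : 'rV[R]_16 :=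
  if n \in N then - sed_unit R n else sed_unit R n.

(* m XOR n < 16 whenever m, n < 16, so inord never truncates (xor_idxE). *)
Definition xor_idx (m n : 'I_16) : 'I_16 := inord (Nat.lxor m n).

Definition fano_set (V : {set 'I_16}) : bool :=
  [&& ord0 \notin V, #|V| == 7%N &
      [forall m in V, forall n in V, (m != n) ==> (xor_idx m n \in V)]].

Definition oct_set : {set 'I_16} := [set n : 'I_16 | (1 <= n <= 7)%N].

(* {a, b, c} is a line of V whose cyclic orientation, computed with the units
   u, is (a, b, c). *)
Definition oriented_line (R : realType) (u : 'I_16 -> 'rV[R]_16)
    (V : {set 'I_16}) (a b c : 'I_16) : Prop :=
  [/\ [/\ a \in V, b \in V & c \in V], a != b, c = xor_idx a b &
      [/\ sed_mul (u a) (u b) = u c, sed_mul (u b) (u c) = u a &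
          sed_mul (u c) (u a) = u b]].

(* The bijection {1, ..., 7} -> V is the restriction of f to oct_set; the values
   of f elsewhere are irrelevant. *)
Definition flowmorphic (R : realType) (u : 'I_16 -> 'rV[R]_16)
    (V : {set 'I_16}) : Prop :=
  exists f : 'I_16 -> 'I_16,
    [/\ {in oct_set &, injective f}, f @: oct_set = V &
        forall a b c : 'I_16, (nat_of_ord a, nat_of_ord b, nat_of_ord c) \in Otrips ->
          oriented_line u V (f a) (f b) (f c)].

Definition harbors_zero_divisors (R : realType) (V : {set 'I_16}) : Prop :=
  exists A B C D : 'I_16,
    [/\ [/\ A \in V, B \in V & A != B], [/\ C \in V, D \in V & C != D] &
        exists s t : bool,
          sed_mul (sed_unit R A + (-1) ^+ s *: sed_unit R B)
                  (sed_unit R C + (-1) ^+ t *: sed_unit R D) = 0].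

Lemma xor_idxE (m n : 'I_16) : xor_idx m n = Nat.lxor m n :> nat.
Proof.
rewrite inordK //.
have: all (fun a => all (fun b => Nat.lxor a b < 16)%N (iota 0 16)) (iota 0 16).
  by vm_compute.
move/allP/(_ (m : nat)); rewrite mem_iota ltn_ord => /(_ isT).
by move/allP/(_ (n : nat)); rewrite mem_iota ltn_ord => /(_ isT).
Qed.

Lemma sed_mul_unit (R : realType) (m n : 'I_16) :
  sed_mul (sed_unit R m) (sed_unit R n) = \row_k sed_coef R m n k.
Proof.
apply/rowP => k; rewrite !mxE (bigD1 m) //= (bigD1 n) //= !mxE !eqxx !mulr1.
rewrite big1 ?addr0 => [|j jn]; last by rewrite !mxE (negbTE jn) !mulr0.
rewrite big1 ?addr0 // => i im; rewrite big1 // => j _.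
by rewrite !mxE (negbTE im) mul0r mulr0.
Qed.

(* The listed triplets decide every product: for distinct m, n in {1, ..., 15},
   exactly one of (m, n, m XOR n), (n, m, m XOR n) is a triplet, and
   (m, n, k) is not one for k <> m XOR n. *)
Lemma is_trip_xor (m n k : 'I_16) : m != ord0 -> n != ord0 -> m != n ->
  is_trip m n k || is_trip n m k = (k == xor_idx m n)
  /\ ~~ (is_trip m n k && is_trip n m k).
Proof.
move=> m0 n0 mn; rewrite -val_eqE /= xor_idxE.
have: all (fun a => all (fun b => all (fun c =>
    [&& a != 0, b != 0 & a != b]%N ==>
    ((is_trip a b c || is_trip b a c == (c == Nat.lxor a b))
     && ~~ (is_trip a b c && is_trip b a c)))
    (iota 0 16)) (iota 0 16)) (iota 0 16) by vm_compute.
move/allP/(_ (m : nat)); rewrite mem_iota ltn_ord => /(_ isT).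
move/allP/(_ (n : nat)); rewrite mem_iota ltn_ord => /(_ isT).
move/allP/(_ (k : nat)); rewrite mem_iota ltn_ord => /(_ isT).
by move: m0 n0 mn; rewrite -!val_eqE /= => -> -> -> /andP[/eqP].
Qed.

(* Main.v *)
(* Since i_m i_n = +- i_(m XOR n), the equation (i_A + s i_B)(i_C + t i_D) = 0 forces
   A XOR C = B XOR D, and then suitable s and t exist iff the four signs involved have
   even total parity.  A flow-preserving bijection onto V, even for negated units, extends
   by 0 |-> 0 to an XOR-additive map that alters the signs by a coboundary; this parity does
   not see coboundaries, and it is always odd in the octonions, so V has no zero-divisors.
   Conversely, let V <> {1, ..., 7} contain e >= 8.  As XOR with e exchanges indices below
   and above 8, V contains distinct a, b < 8.  If 8 is in V, then a, b and 8 generate V, a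
   Cayley-Dickson double of the quaternion triplet through a and b, hence a copy of the
   octonions; there is one such V for each of the seven O-trips.  If 8 is not in V, the
   indices A = a, B = a XOR e, C = b, D = b XOR e give a zero-divisor. *)
From Stdlib Require PeanoNat.
Require Import Defs.
From mathcomp Require Import all_boot all_order all_algebra.
From mathcomp Require Import reals.

Set Implicit Arguments.
Unset Strict Implicit.
Unset Printing Implicit Defensive.

Import GRing.Theory Num.Theory.
Local Open Scope ring_scope.

Lemma all_iota_ord n (p : pred nat) : all p (iota 0 n) -> forall i : 'I_n, p i.
Proof. by move=> /allP p_all i; apply: p_all; rewrite mem_iota ltn_ord. Qed.

Lemma all_iota_ord2 n (p : rel nat) :
  all (fun i => all (p i) (iota 0 n)) (iota 0 n) -> forall i j : 'I_n, p i j.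
Proof. by move=> p_all i; apply/all_iota_ord/(all_iota_ord p_all). Qed.

Lemma all_iota_ord3 n (p : nat -> rel nat) :
  all (fun i => all (fun j => all (p i j) (iota 0 n)) (iota 0 n)) (iota 0 n) ->
  forall i j k : 'I_n, p i j k.
Proof. by move=> p_all i; apply/all_iota_ord2/(all_iota_ord p_all). Qed.

Lemma card_set_ord n (p : pred nat) : #|[set i : 'I_n | p i]| = count p (iota 0 n).
Proof. by rewrite cardsE cardE size_filter -val_enum_ord count_map enumT. Qed.

Lemma disjoint_support_add_eq0 (U : zmodType) n (x y : 'rV[U]_n) :
  (forall k, (x 0 k == 0) || (y 0 k == 0)) -> x + y = 0 <-> x = 0 /\ y = 0.
Proof.
move=> disj; split=> [xy0|[-> ->]]; last exact: addr0.
have coord0 k : x 0 k = 0 /\ y 0 k = 0.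
  move/rowP/(_ k): xy0; rewrite !mxE.
  by case/orP: (disj k) => /eqP->; rewrite ?add0r ?addr0.
by split; apply/rowP => k; rewrite mxE; have [] := coord0 k.
Qed.

Lemma xor_idxC : commutative xor_idx.
Proof. by move=> m n; apply/val_inj; rewrite /= !xor_idxE PeanoNat.Nat.lxor_comm. Qed.

Lemma xor_idxA : associative xor_idx.
Proof. by move=> m n p; apply/val_inj; rewrite /= !xor_idxE PeanoNat.Nat.lxor_assoc. Qed.

Lemma xor_0idx : left_id ord0 xor_idx.
Proof. by move=> n; apply/val_inj; rewrite /= xor_idxE PeanoNat.Nat.lxor_0_l. Qed.

Lemma xor_idx0 : right_id ord0 xor_idx.
Proof. by move=> n; rewrite xor_idxC xor_0idx. Qed.

Lemma xor_idxx : self_inverse ord0 xor_idx.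
Proof. by move=> n; apply/val_inj; rewrite /= xor_idxE PeanoNat.Nat.lxor_nilpotent. Qed.

Lemma xor_idxK m : involutive (xor_idx m).
Proof. by move=> n; rewrite xor_idxA xor_idxx xor_0idx. Qed.

Lemma xor_idx_inj m : injective (xor_idx m).
Proof. exact: inv_inj (@xor_idxK m). Qed.

Lemma xor_idx_injl m : injective (xor_idx^~ m).
Proof. by move=> n p; rewrite !(xor_idxC _ m) => /xor_idx_inj. Qed.

Lemma xor_idx_eq0 m n : (xor_idx m n == ord0) = (m == n).
Proof. by rewrite -(xor_idxx m) (inj_eq (@xor_idx_inj m)) eq_sym. Qed.

Lemma xor_idx_swap m n p q : xor_idx m p = xor_idx n q -> xor_idx m q = xor_idx n p.
Proof.
move=> mp_nq; have -> : m = xor_idx (xor_idx n q) p.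
  by rewrite -mp_nq -xor_idxA xor_idxx xor_idx0.
by rewrite -!xor_idxA (xor_idxC p) xor_idxK.
Qed.

Lemma xor_idx_lt8 m n : (xor_idx m n < 8)%N = ((m < 8)%N == (n < 8)%N).
Proof.
rewrite xor_idxE.
exact: (eqP (@all_iota_ord2 16 (fun m n =>
  (Nat.lxor m n < 8) == ((m < 8) == (n < 8)))%N isT m n)).
Qed.

Lemma mem_oct_set n : (n \in oct_set) = (n != ord0) && (n < 8)%N.
Proof. by rewrite inE lt0n. Qed.

Lemma oct_set_xor m n : m \in oct_set -> n \in oct_set -> m != n -> xor_idx m n \in oct_set.
Proof.
by rewrite !mem_oct_set xor_idx_lt8 xor_idx_eq0 => /andP[_ ->] /andP[_ ->] ->.
Qed.

(* No triplet repeats an index, so [m = n] receives the sign of [i_m i_m = - 1]. *)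
Definition sed_sign (m n : nat) : bool :=
  [&& m != 0, n != 0 & ~~ is_trip m n (Nat.lxor m n)]%N.

Definition is_Otrip (a b c : nat) : bool := (a, b, c) \in Otrips.

Lemma is_Otrip_trip a b c : is_Otrip a b c -> is_trip a b c.
Proof. by rewrite /is_Otrip /is_trip mem_cat => ->. Qed.

Lemma is_trip_rot a b c : is_trip a b c = is_trip b c a.
Proof. by rewrite /is_trip orbC -orbA. Qed.

Lemma is_trip_xor_idx (a b c : 'I_16) : is_trip a b c ->
  [/\ a != ord0, b != ord0, a != b & c = xor_idx a b].
Proof.
have : is_trip a b c ==> [&& a != ord0, b != ord0, a != b & c == xor_idx a b].
  rewrite -!val_eqE /= xor_idxE; move: a b c; apply: (@all_iota_ord3 16 (fun a b c =>
    is_trip a b c ==> [&& a != 0, b != 0, a != b & c == Nat.lxor a b]%N)).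
  by vm_compute.
by move=> /implyP trip /trip/and4P[? ? ? /eqP].
Qed.

Lemma sed_sign_diag (m : 'I_16) : m != ord0 -> sed_sign m m.
Proof.
rewrite /sed_sign -val_eqE => /= ->.
by apply/negP; rewrite -xor_idxE => /is_trip_xor_idx[_ _ /eqP].
Qed.

Lemma sed_sign_trip (a b c : 'I_16) : is_trip a b c -> sed_sign a b = false.
Proof.
move=> trip; have [_ _ _ cE] := is_trip_xor_idx trip.
by rewrite /sed_sign -xor_idxE -cE trip !andbF.
Qed.

Lemma sed_signC (m n : 'I_16) :
  m != ord0 -> n != ord0 -> m != n -> sed_sign n m = ~~ sed_sign m n.
Proof.
move=> m0 n0 mn; have [] := is_trip_xor (xor_idx m n) m0 n0 mn.
rewrite eqxx /sed_sign -!xor_idxE (xor_idxC n m).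
rewrite -!val_eqE /= in m0 n0; rewrite m0 n0 /=.
by do 2!case: (is_trip _ _ _).
Qed.

Section SedenionProduct.

Variable R : realType.
Implicit Types (x y : 'rV[R]_16) (N V : {set 'I_16}).

Local Notation i_ := (sed_unit R).

Lemma sed_mulDl : left_distributive (@sed_mul R) +%R.
Proof.
move=> x y z; apply/rowP => k; rewrite !mxE -big_split; apply: eq_bigr => m _ /=.
by rewrite -big_split; apply: eq_bigr => n _ /=; rewrite mxE mulrDl mulrDr.
Qed.

Lemma sed_mulDr : right_distributive (@sed_mul R) +%R.
Proof.
move=> x y z; apply/rowP => k; rewrite !mxE -big_split; apply: eq_bigr => m _ /=.
by rewrite -big_split; apply: eq_bigr => n _ /=; rewrite mxE !mulrDr.
Qed.

Lemma sed_mulZl (a : R) x y : sed_mul (a *: x) y = a *: sed_mul x y.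
Proof.
apply/rowP => k; rewrite !mxE big_distrr; apply: eq_bigr => m _ /=.
rewrite big_distrr; apply: eq_bigr => n _ /=.
by rewrite mxE -(mulrA a) mulrCA.
Qed.

Lemma sed_mulZr (a : R) x y : sed_mul x (a *: y) = a *: sed_mul x y.
Proof.
apply/rowP => k; rewrite !mxE big_distrr; apply: eq_bigr => m _ /=.
rewrite big_distrr; apply: eq_bigr => n _ /=.
by rewrite mxE [RHS]mulrCA (mulrCA a).
Qed.

Lemma sed_mul_unitE (m n : 'I_16) :
  sed_mul (i_ m) (i_ n) = (-1) ^+ sed_sign m n *: i_ (xor_idx m n).
Proof.
rewrite sed_mul_unit; apply/rowP => k; rewrite !mxE eqxx /= /sed_coef.
have [->|m0] := eqVneq m ord0; first by rewrite xor_0idx mul1r.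
have [->|n0] := eqVneq n ord0; first by rewrite xor_idx0 /sed_sign andbF mul1r.
have [<-|mn] := eqVneq m n; first by rewrite xor_idxx sed_sign_diag // mulN1r.
have [] := is_trip_xor k m0 n0 mn.
rewrite /sed_sign -xor_idxE -!val_eqE /= in m0 n0 *; rewrite m0 n0 val_eqE /=.
have [->|_] := eqVneq k (xor_idx m n).
  by case: (is_trip m n _) => /= [_ _|-> _]; rewrite ?mulr1 // expr0.
by move=> /norP[/negPf-> /negPf->]; rewrite mulr0.
Qed.

Lemma signed_unit_inj (s t : bool) m n :
  (-1) ^+ s *: i_ m = (-1) ^+ t *: i_ n -> m = n /\ s = t.
Proof.
move=> /rowP/(_ m); rewrite !mxE !eqxx /= mulr1.
have [<-|_] := eqVneq m n; first by rewrite mulr1 => /signr_inj.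
by rewrite mulr0 => /eqP; rewrite signr_eq0.
Qed.

Lemma signed_units_cancel (s t : bool) m n :
  (-1) ^+ s *: i_ m + (-1) ^+ t *: i_ n = 0 <-> m = n /\ s (+) t.
Proof.
split=> [/eqP|[-> st]].
  rewrite addr_eq0 -scaleNr -signrN => /eqP/signed_unit_inj[-> ->].
  by split=> //; case: t.
by rewrite -scalerDl; case: s t st => -[] //= _; rewrite ?addNr ?subrr scale0r.
Qed.

Definition sign_obstruction (A B C D : nat) : bool :=
  sed_sign A C (+) sed_sign B D (+) (sed_sign A D (+) sed_sign B C).

Lemma sed_mul_unit_pair_eq0 (A B C D : 'I_16) (s t : bool) : A != B -> C != D ->
  sed_mul (i_ A + (-1) ^+ s *: i_ B) (i_ C + (-1) ^+ t *: i_ D) = 0 <->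
  [/\ xor_idx A C = xor_idx B D, sed_sign A C (+) (s (+) t (+) sed_sign B D) &
      t (+) sed_sign A D (+) (s (+) sed_sign B C)].
Proof.
move=> AB CD.
have -> : sed_mul (i_ A + (-1) ^+ s *: i_ B) (i_ C + (-1) ^+ t *: i_ D) =
    ((-1) ^+ sed_sign A C *: i_ (xor_idx A C) +
     (-1) ^+ (s (+) t (+) sed_sign B D) *: i_ (xor_idx B D)) +
    ((-1) ^+ (t (+) sed_sign A D) *: i_ (xor_idx A D) +
     (-1) ^+ (s (+) sed_sign B C) *: i_ (xor_idx B C)).
  rewrite sed_mulDl !sed_mulDr !sed_mulZl !sed_mulZr !sed_mul_unitE.
  by rewrite !scalerA -!signr_addb [X in _ + X = _]addrC addrACA.
rewrite disjoint_support_add_eq0 => [|k].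
  rewrite !signed_units_cancel; split=> [[[-> ?] [_ ?]]|[AC_BD ? ?]] //.
  by rewrite AC_BD (xor_idx_swap AC_BD).
rewrite !mxE eqxx /=.
have neql X : xor_idx X C == xor_idx X D = false.
  by rewrite (inj_eq (@xor_idx_inj X)) (negPf CD).
have neqr X : xor_idx A X == xor_idx B X = false.
  by rewrite (inj_eq (@xor_idx_injl X)) (negPf AB).
have [->|_] := eqVneq k (xor_idx A C); first by rewrite neql neqr !mulr0 addr0 eqxx orbT.
have [->|_] := eqVneq k (xor_idx B D); last by rewrite !mulr0 addr0 eqxx.
by rewrite ![xor_idx B D == _]eq_sym neql neqr !mulr0 addr0 eqxx orbT.
Qed.

Lemma harbors_zero_divisorsP V :
  harbors_zero_divisors R V <->
  exists A B C D : 'I_16,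
    [/\ [/\ A \in V, B \in V & A != B], [/\ C \in V, D \in V & C != D],
        xor_idx A C = xor_idx B D & ~~ sign_obstruction A B C D].
Proof.
rewrite /sign_obstruction; split=> -[A [B [C [D]]]].
  case=> ABV CDV [s [t]]; have [[_ _ AB] [_ _ CD]] := (ABV, CDV).
  case/(sed_mul_unit_pair_eq0 _ _ AB CD) => AC_BD sgn1 sgn2; exists A, B, C, D; split=> //.
  by move: s t (sed_sign A C) (sed_sign B D) (sed_sign A D) (sed_sign B C) sgn1 sgn2; do 6!case.
(* Both cancellations depend on [s] and [t] through [s (+) t] only. *)
case=> ABV CDV AC_BD unobstructed; exists A, B, C, D; split=> //.
exists (~~ (sed_sign A C (+) sed_sign B D)), false.
have [[_ _ AB] [_ _ CD]] := (ABV, CDV).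
apply/sed_mul_unit_pair_eq0 => //; split=> //.
  by case: (sed_sign A C) (sed_sign B D) => -[].
by move: (sed_sign A C) (sed_sign B D) (sed_sign A D) (sed_sign B C) unobstructed; do 4!case.
Qed.

Lemma neg_unitsE N n : neg_units R N n = (-1) ^+ (n \in N) *: i_ n.
Proof. by rewrite /neg_units; case: ifP; rewrite ?scaleN1r ?scale1r. Qed.

Lemma neg_units_mulP N (a b c : 'I_16) :
  sed_mul (neg_units R N a) (neg_units R N b) = neg_units R N c <->
  c = xor_idx a b /\ sed_sign a b = (a \in N) (+) (b \in N) (+) (c \in N).
Proof.
rewrite !neg_unitsE sed_mulZl sed_mulZr sed_mul_unitE !scalerA -!signr_addb.
split=> [/signed_unit_inj[-> <-]|[-> ->]].
  by split=> //; do 2!case: (_ \in N); case: (sed_sign a b).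
by congr ((-1) ^+ (nat_of_bool _) *: _); do 3!case: (_ \in N).
Qed.

Lemma flowmorphic_neg_units0 V :
  flowmorphic i_ V <-> flowmorphic (neg_units R set0) V.
Proof.
by split=> -[f [f_inj f_img f_flow]]; exists f; split=> // a b c /f_flow;
  rewrite /oriented_line /neg_units !inE.
Qed.

End SedenionProduct.

Lemma oct_set_trip_rot (a b c : 'I_16) : a \in oct_set -> b \in oct_set -> is_trip a b c ->
  [|| is_Otrip a b c, is_Otrip b c a | is_Otrip c a b].
Proof.
move=> aO bO trip; rewrite !inE in aO bO.
have := @all_iota_ord3 16 (fun a b c => [&& 1 <= a <= 7, 1 <= b <= 7 & is_trip a b c] ==>
  [|| is_Otrip a b c, is_Otrip b c a | is_Otrip c a b])%N
  ltac:(by vm_compute) a b c.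
by rewrite aO bO trip.
Qed.

Lemma oct_set_trip_or (a b : 'I_16) : a \in oct_set -> b \in oct_set -> a != b ->
  is_trip a b (xor_idx a b) \/ is_trip b a (xor_idx a b).
Proof.
rewrite !mem_oct_set => /andP[a0 _] /andP[b0 _] ab; apply/orP.
by have [-> _] := is_trip_xor (xor_idx a b) a0 b0 ab; apply: eqxx.
Qed.

Lemma oct_sign_obstruction (a b c d : 'I_16) :
  (a < 8)%N -> (b < 8)%N -> (c < 8)%N -> a != b -> xor_idx a c = xor_idx b d ->
  sign_obstruction a b c d.
Proof.
move=> a8 b8 c8 ab ac_bd.
have -> : d = xor_idx b (xor_idx a c) by rewrite ac_bd xor_idxK.
have := @all_iota_ord3 16 (fun a b c => [&& a < 8, b < 8, c < 8 & a != b] ==>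
  sign_obstruction a b c (Nat.lxor b (Nat.lxor a c)))%N ltac:(by vm_compute) a b c.
by rewrite a8 b8 c8 val_eqE ab !xor_idxE.
Qed.

Section FlowMap.

Variables (R : realType) (N V : {set 'I_16}) (f : 'I_16 -> 'I_16).

Hypothesis N_not0 : ord0 \notin N.
Hypothesis f_neq0 : {in oct_set, forall n, f n != ord0}.
Hypothesis f_inj : {in oct_set &, injective f}.
Hypothesis f_flow : forall a b c : 'I_16, is_Otrip a b c ->
  oriented_line (neg_units R N) V (f a) (f b) (f c).

Lemma flow_trip (a b c : 'I_16) : a \in oct_set -> b \in oct_set -> is_trip a b c ->
  f c = xor_idx (f a) (f b) /\
  sed_sign (f a) (f b) = (f a \in N) (+) (f b \in N) (+) (f c \in N).
Proof.
move=> aO bO trip; apply/(neg_units_mulP R).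
by case/or3P: (oct_set_trip_rot aO bO trip) => /f_flow[_ _ _ []].
Qed.

Definition flow_ext (n : 'I_16) : 'I_16 := if n == ord0 then ord0 else f n.

Lemma flow_ext_inj : {in [pred n : 'I_16 | (n < 8)%N] &, injective flow_ext}.
Proof.
move=> m n; rewrite /flow_ext !inE => m8 n8.
have [->|m0] := eqVneq m ord0; have [->|n0] := eqVneq n ord0 => //.
- by move/esym/eqP; rewrite (negPf (f_neq0 _)) // mem_oct_set n0.
- by move/eqP; rewrite (negPf (f_neq0 _)) // mem_oct_set m0.
by apply: f_inj; rewrite mem_oct_set ?m0 ?n0.
Qed.

Lemma flow_ext_xor_sign (a b : 'I_16) : (a < 8)%N -> (b < 8)%N ->
  flow_ext (xor_idx a b) = xor_idx (flow_ext a) (flow_ext b) /\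
  sed_sign (flow_ext a) (flow_ext b) = sed_sign a b (+)
    ((flow_ext a \in N) (+) (flow_ext b \in N) (+) (flow_ext (xor_idx a b) \in N)).
Proof.
move=> a8 b8.
have ext0 : flow_ext ord0 = ord0 by rewrite /flow_ext eqxx.
have extE n : n != ord0 -> flow_ext n = f n by rewrite /flow_ext => /negPf->.
have [->|a0] := eqVneq a ord0; first by rewrite ext0 !xor_0idx (negPf N_not0) addFb addbb.
have [->|b0] := eqVneq b ord0.
  by rewrite ext0 !xor_idx0 (negPf N_not0) /sed_sign !andbF addbF addbb.
have aO : a \in oct_set by rewrite mem_oct_set a0.
have bO : b \in oct_set by rewrite mem_oct_set b0.
have [<-|ab] := eqVneq a b.
  by rewrite !xor_idxx ext0 extE // !sed_sign_diag ?f_neq0 // (negPf N_not0) addbb.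
rewrite !extE // ?xor_idx_eq0 //.
have [trip|trip] := oct_set_trip_or aO bO ab.
  by have [-> ->] := flow_trip aO bO trip; rewrite (sed_sign_trip trip).
have [fxor fsign] := flow_trip bO aO trip.
split; first by rewrite fxor xor_idxC.
have fba : f b != f a by apply: contra_neq ab => /f_inj->.
have ba : b != a by rewrite eq_sym.
rewrite (sed_signC b0 a0 ba) (sed_sign_trip trip) (sed_signC _ _ fba) ?f_neq0 // fsign.
by rewrite (addbC (f b \in N)).
Qed.

Lemma flow_ext_sign_obstruction (a b c d : 'I_16) :
  (a < 8)%N -> (b < 8)%N -> (c < 8)%N -> (d < 8)%N -> xor_idx a c = xor_idx b d ->
  sign_obstruction (flow_ext a) (flow_ext b) (flow_ext c) (flow_ext d) =
  sign_obstruction a b c d.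
Proof.
(* Each value of [n |-> (flow_ext n \in N)] enters exactly two of the four signs. *)
move=> a8 b8 c8 d8 ac_bd; rewrite /sign_obstruction.
have [[_ ->] [_ ->]] := (flow_ext_xor_sign a8 c8, flow_ext_xor_sign b8 d8).
have [[_ ->] [_ ->]] := (flow_ext_xor_sign a8 d8, flow_ext_xor_sign b8 c8).
rewrite ac_bd (xor_idx_swap ac_bd).
move: (sed_sign a c) (sed_sign b d) (sed_sign a d) (sed_sign b c) => s t s' t'.
by do 6!case: (_ \in N); case: s t s' t' => [] [] [] [].
Qed.

End FlowMap.

Lemma flowmorphic_no_zero_divisors (R : realType) (N V : {set 'I_16}) :
  ord0 \notin V -> N \subset V -> flowmorphic (neg_units R N) V ->
  ~ harbors_zero_divisors R V.
Proof.
move=> V_not0 NV [f [f_inj f_img f_flow]] /harbors_zero_divisorsP[A [B [C [D]]]].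
have N_not0 : ord0 \notin N by apply: contra V_not0; apply: subsetP.
have f_neq0 : {in oct_set, forall n, f n != ord0}.
  by move=> n nO; apply: contraNneq V_not0 => <-; rewrite -f_img imset_f.
have V_ext n : n \in V -> exists2 m : 'I_16, (m < 8)%N & n = flow_ext f m.
  rewrite -f_img => /imsetP[m]; rewrite mem_oct_set /flow_ext => /andP[m0 m8] ->.
  by exists m; rewrite ?(negPf m0).
have ext_sign := flow_ext_xor_sign N_not0 f_neq0 f_inj f_flow.
case=> [[/V_ext[a a8 ->] /V_ext[b b8 ->] AB] [/V_ext[c c8 ->] /V_ext[d d8 ->] _]].
have [[<- _] [<- _]] := (ext_sign _ _ a8 c8, ext_sign _ _ b8 d8).
move/(flow_ext_inj f_neq0 f_inj); rewrite !inE !xor_idx_lt8 a8 b8 c8 d8 => /(_ isT isT) ac_bd.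
rewrite (flow_ext_sign_obstruction N_not0 f_neq0 f_inj f_flow) // oct_sign_obstruction //.
by apply: contra_neq AB => ->.
Qed.

Section FanoSets.

Variable V : {set 'I_16}.
Hypothesis fanoV : fano_set V.

Lemma fano_set_notin0 : ord0 \notin V.
Proof. by have [] := and3P fanoV. Qed.

Lemma fano_set_neq0 n : n \in V -> n != ord0.
Proof. by move=> nV; apply: contraNneq fano_set_notin0 => <-. Qed.

Lemma card_fano_set : #|V| = 7%N.
Proof. by have [_ /eqP] := and3P fanoV. Qed.

Lemma fano_set_xor m n : m \in V -> n \in V -> m != n -> xor_idx m n \in V.
Proof.
have [_ _ /forall_inP V_xor] := and3P fanoV.
by move=> mV nV; apply/implyP; move: n nV; apply/forall_inP/V_xor.
Qed.

Lemma card_fano_set_oct_gt1 e : e \in V -> e \notin oct_set -> (1 < #|V :&: oct_set|)%N.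
Proof.
move=> eV eO; have := card_fano_set.
have eVO : e \in V :\: oct_set by rewrite in_setD eO.
rewrite -(cardsID oct_set V) (cardsD1 e (V :\: oct_set)) eVO.
suff : (#|(V :\: oct_set) :\ e| <= #|V :&: oct_set|)%N.
  by case: #|V :&: oct_set| => [|[|//]]; case: #|_ :\ e| => [|[|]].
rewrite -(card_imset _ (@xor_idx_inj e)); apply/subset_leq_card/subsetP => _ /imsetP[n + ->].
rewrite in_setD1 in_setD in_setI => /and3P[ne nO nV].
rewrite fano_set_xor 1?eq_sym //= mem_oct_set xor_idx_eq0 eq_sym ne xor_idx_lt8.
move: eO nO; rewrite !mem_oct_set fano_set_neq0 // fano_set_neq0 //=.
by do 2!case: (_ < 8)%N.
Qed.

End FanoSets.

Lemma fano_oct_set : fano_set oct_set.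
Proof.
apply/and3P; split; first by rewrite mem_oct_set.
  by apply/eqP/(@card_set_ord 16 (fun n => 1 <= n <= 7)%N).
apply/forall_inP => m mO; apply/forall_inP => n nO; apply/implyP.
exact: oct_set_xor.
Qed.

(* The inequalities say that [a], [b] and [e XOR 8] are linearly independent over F_2. *)
Lemma unobstructed_shift (a b e : 'I_16) :
  a \in oct_set -> b \in oct_set -> a != b -> (8 < e)%N ->
  xor_idx a e != inord 8 -> xor_idx b e != inord 8 -> xor_idx (xor_idx a b) e != inord 8 ->
  ~~ sign_obstruction a (xor_idx a e) b (xor_idx b e).
Proof.
rewrite !inE -!val_eqE /= !xor_idxE inordK // => aO bO ab e8 ae8 be8 abe8.
have := @all_iota_ord3 16 (fun a b e =>
  [&& 1 <= a <= 7, 1 <= b <= 7, a != b & 8 < e] ==>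
  [&& Nat.lxor a e != 8, Nat.lxor b e != 8 & Nat.lxor (Nat.lxor a b) e != 8] ==>
  ~~ sign_obstruction a (Nat.lxor a e) b (Nat.lxor b e))%N ltac:(by vm_compute) a b e.
by rewrite aO bO ab e8 ae8 be8 abe8.
Qed.

Lemma fano_set_zero_divisors (R : realType) (V : {set 'I_16}) :
  fano_set V -> V != oct_set -> inord 8 \notin V -> harbors_zero_divisors R V.
Proof.
move=> fanoV V_oct V8.
have neq8 n : n \in V -> n != inord 8 by apply: contraTneq => ->.
have [e eV eO] : exists2 e, e \in V & e \notin oct_set.
  apply/subsetPn; apply: contra V_oct => VO.
  by rewrite eqEcard VO (card_fano_set fanoV) (card_fano_set fano_oct_set).
have e_gt8 : (8 < e)%N.
  rewrite ltn_neqAle eq_sym; move: (neq8 e eV) eO; rewrite -val_eqE /= inordK // => ->.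
  by rewrite mem_oct_set (fano_set_neq0 fanoV) // -leqNgt.
have [a [b []]] := card_gt1P (card_fano_set_oct_gt1 fanoV eV eO).
rewrite !in_setI => /andP[aV aO] /andP[bV bO] ab.
have ae : a != e by apply: contraNneq eO => <-.
have be : b != e by apply: contraNneq eO => <-.
have abe : xor_idx a b != e by apply: contraNneq eO => <-; apply: oct_set_xor.
have shift_neq n : xor_idx n e != n.
  by rewrite -[X in _ != X]xor_idx0 (inj_eq (@xor_idx_inj n)) (fano_set_neq0 fanoV).
apply/harbors_zero_divisorsP; exists a, (xor_idx a e), b, (xor_idx b e).
split; first by split; rewrite ?fano_set_xor // eq_sym.
- by split; rewrite ?fano_set_xor // eq_sym.
- by rewrite -xor_idxA (xor_idxC b) xor_idxK.
by apply: unobstructed_shift; rewrite // neq8 ?fano_set_xor.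
Qed.

Definition xor_basis3 (T : Type) (xor : T -> T -> T) (a b c : T) : seq T :=
  [:: a; b; xor a b; c; xor a c; xor b c; xor (xor a b) c].

Lemma map_xor_basis3 (a b c : 'I_16) :
  map val (xor_basis3 xor_idx a b c) = xor_basis3 Nat.lxor a b c.
Proof. by rewrite /xor_basis3 /= !xor_idxE. Qed.

Lemma uniq_xor_basis3 (a b c : 'I_16) :
  a != ord0 -> b != ord0 -> a != b -> c != ord0 -> c \notin [:: a; b; xor_idx a b] ->
  uniq (xor_basis3 xor_idx a b c).
Proof.
rewrite -(map_inj_uniq val_inj) map_xor_basis3 -(mem_map val_inj) -!val_eqE /= xor_idxE.
move=> a0 b0 ab c0 c_ab; have := @all_iota_ord3 16 (fun a b c =>
  [&& a != 0, b != 0, a != b, c != 0 & c \notin [:: a; b; Nat.lxor a b]] ==>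
  uniq (xor_basis3 Nat.lxor a b c))%N ltac:(by vm_compute) a b c.
by rewrite a0 b0 ab c0 c_ab.
Qed.

Lemma fano_set_basis (V : {set 'I_16}) (a b c : 'I_16) :
  fano_set V -> a \in V -> b \in V -> a != b -> c \in V -> c \notin [:: a; b; xor_idx a b] ->
  V =i xor_basis3 xor_idx a b c.
Proof.
move=> fanoV aV bV ab cV c_ab; have neq0 := fano_set_neq0 fanoV.
have abV := fano_set_xor fanoV aV bV ab.
have [ca cb cab] : [/\ a != c, b != c & xor_idx a b != c].
  by move: c_ab; rewrite !inE !negb_or => /and3P[]; rewrite ![c == _]eq_sym; split.
have basisV : {subset xor_basis3 xor_idx a b c <= V}.
  by apply/allP; rewrite /= aV bV cV abV !fano_set_xor.
have basis_uniq := uniq_xor_basis3 (neq0 _ aV) (neq0 _ bV) ab (neq0 _ cV) c_ab.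
apply/fsym/subset_cardP; last by apply/subsetP.
by rewrite (card_uniqP basis_uniq) (card_fano_set fanoV).
Qed.

Lemma fano_set_Otrip (V : {set 'I_16}) e : fano_set V -> e \in V -> e \notin oct_set ->
  exists a b c : 'I_16, [/\ a \in V, b \in V & is_Otrip a b c].
Proof.
move=> fanoV eV eO.
have [a [b [aVO bVO ab]]] := card_gt1P (card_fano_set_oct_gt1 fanoV eV eO).
wlog trip : a b aVO bVO ab / is_trip a b (xor_idx a b).
  move=> wlog_ab; have [/setIP[_ aO] /setIP[_ bO]] := (aVO, bVO).
  have [|trip] := oct_set_trip_or aO bO ab; first exact: wlog_ab.
  by apply: (wlog_ab b a); rewrite ?(xor_idxC b) // eq_sym.
have [/setIP[aV aO] /setIP[bV bO]] := (aVO, bVO).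
have abV := fano_set_xor fanoV aV bV ab.
by case/or3P: (oct_set_trip_rot aO bO trip) => ?;
  [exists a, b, (xor_idx a b)|exists b, (xor_idx a b), a|exists (xor_idx a b), a, b].
Qed.

Definition double_seq (t : nat * nat * nat) : seq nat := xor_basis3 Nat.lxor t.1.1 t.1.2 8.

Definition double_idx (t : nat * nat * nat) (n : nat) : nat := nth 0%N (double_seq t) n.-1.

Lemma is_trip_double t (a b c : nat) : t \in Otrips -> is_Otrip a b c ->
  is_trip (double_idx t a) (double_idx t b) (double_idx t c).
Proof.
move=> tO abc; have /allP/(_ t tO)/allP/(_ _ abc) : all (fun t => all (fun u =>
    is_trip (double_idx t u.1.1) (double_idx t u.1.2) (double_idx t u.2)) Otrips) Otrips.
  by vm_compute.
exact.
Qed.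

Lemma oriented_line_trip (R : realType) (V : {set 'I_16}) (a b c : 'I_16) :
  a \in V -> b \in V -> c \in V -> is_trip a b c -> oriented_line (sed_unit R) V a b c.
Proof.
have unit_mul (m n p : 'I_16) :
    is_trip m n p -> sed_mul (sed_unit R m) (sed_unit R n) = sed_unit R p.
  move=> trip; have [_ _ _ ->] := is_trip_xor_idx trip.
  by rewrite sed_mul_unitE (sed_sign_trip trip) scale1r.
move=> aV bV cV trip; have [_ _ ab cE] := is_trip_xor_idx trip.
by split=> //; split; apply: unit_mul; rewrite // is_trip_rot // is_trip_rot.
Qed.

Lemma is_Otrip_oct_set (a b c : 'I_16) : is_Otrip a b c ->
  [/\ a \in oct_set, b \in oct_set & c \in oct_set].
Proof.
have /allP oct : all (fun t => [&& 1 <= t.1.1 <= 7, 1 <= t.1.2 <= 7 & 1 <= t.2 <= 7]%N) Otrips.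
  by [].
by move=> /oct/and3P[]; rewrite !inE.
Qed.

Lemma oct_set_flowmorphic (R : realType) : flowmorphic (sed_unit R) oct_set.
Proof.
exists id; split=> [//||a b c abc]; first exact: imset_id.
have [aO bO cO] := is_Otrip_oct_set abc.
exact/oriented_line_trip/is_Otrip_trip.
Qed.

Definition oct_double (t : nat * nat * nat) : {set 'I_16} :=
  [set n : 'I_16 | (n : nat) \in double_seq t].

Lemma double_seq_fano t : t \in Otrips ->
  [/\ uniq (double_seq t), all (fun n => 0 < n < 16)%N (double_seq t),
      count (mem (double_seq t)) (iota 0 16) == 7%N &
      all (fun m => all (fun n => (m != n) ==> (Nat.lxor m n \in double_seq t))
        (double_seq t)) (double_seq t)].
Proof.
have /allP fano : all (fun t => [&& uniq (double_seq t),
    all (fun n => 0 < n < 16)%N (double_seq t), count (mem (double_seq t)) (iota 0 16) == 7%N &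
    all (fun m => all (fun n => (m != n) ==> (Nat.lxor m n \in double_seq t))
      (double_seq t)) (double_seq t)]) Otrips by vm_compute.
by move=> /fano/and4P.
Qed.

Lemma fano_oct_double t : t \in Otrips -> fano_set (oct_double t).
Proof.
move=> /double_seq_fano[_ /allP s_range s_card /allP s_xor]; apply/and3P; split.
- by rewrite in_set; apply/negP => /s_range.
- by rewrite (@card_set_ord 16 (mem (double_seq t))).
apply/forall_inP => m; rewrite in_set => /s_xor/allP m_xor.
apply/forall_inP => n; rewrite in_set => /m_xor.
by rewrite in_set xor_idxE.
Qed.

Lemma oct_double_inj : {in Otrips &, injective oct_double}.
Proof.
move=> t u tO uO tu; apply/eqP.
have separated : all (fun t => all (fun u =>
    all (fun n => (n \in double_seq t) == (n \in double_seq u)) (iota 0 16) ==> (t == u))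
  Otrips) Otrips by vm_compute.
move/allP/(_ t tO)/allP/(_ u uO)/implyP: separated; apply.
apply/allP => n; rewrite mem_iota add0n => /andP[_ n16].
by have /setP/(_ (Ordinal n16)) := tu; rewrite !in_set /= => ->.
Qed.

Lemma oct_double_flowmorphic (R : realType) t :
  t \in Otrips -> flowmorphic (sed_unit R) (oct_double t).
Proof.
move=> tO; have [basis_uniq /allP basis_lt16 _ _] := double_seq_fano tO.
have pred_lt (n : 'I_16) : n \in oct_set -> (n.-1 < size (double_seq t))%N.
  by rewrite inE; case: (n : nat).
pose f (n : 'I_16) : 'I_16 := inord (double_idx t n).
have f_val n : n \in oct_set -> f n = double_idx t n :> nat.
  by move=> /pred_lt/(mem_nth 0%N)/basis_lt16/andP[_ ?]; rewrite /f inordK.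
have fV n : n \in oct_set -> f n \in oct_double t.
  by move=> nO; rewrite in_set f_val // mem_nth // pred_lt.
have f_inj : {in oct_set &, injective f}.
  move=> m n mO nO /(congr1 val)/eqP; rewrite /= !f_val // nth_uniq ?pred_lt // => /eqP mn.
  move: mO nO; rewrite !inE => /andP[m0 _] /andP[n0 _].
  by apply/val_inj; rewrite /= -(prednK m0) mn prednK.
exists f; split=> // [|i j k ijk].
  apply/eqP; rewrite eqEcard card_in_imset // !card_fano_set ?fano_oct_set ?fano_oct_double //.
  by rewrite andbT; apply/subsetP => _ /imsetP[n nO ->]; apply: fV.
have [iO jO kO] := is_Otrip_oct_set ijk.
by apply: oriented_line_trip; rewrite ?fV ?f_val //; apply: (is_trip_double tO ijk).
Qed.

Lemma fano_set8_double (V : {set 'I_16}) : fano_set V -> inord 8 \in V ->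
  exists2 t, t \in Otrips & V = oct_double t.
Proof.
move=> fanoV V8; have O8 : inord 8 \notin oct_set by rewrite inE inordK.
have [a [b [c [aV bV abc]]]] := fano_set_Otrip fanoV V8 O8.
have [aO bO _] := is_Otrip_oct_set abc.
have [_ _ ab _] := is_trip_xor_idx (is_Otrip_trip abc).
have oct_neq8 n : n \in oct_set -> inord 8 != n by move=> nO; apply: contraNneq O8 => ->.
have indep8 : inord 8 \notin [:: a; b; xor_idx a b].
  by rewrite !inE !negb_or !oct_neq8 // oct_set_xor.
exists (nat_of_ord a, nat_of_ord b, nat_of_ord c) => //; apply/setP => n.
rewrite (fano_set_basis fanoV aV bV ab V8 indep8) in_set.
by rewrite -(mem_map val_inj) map_xor_basis3 inordK.
Qed.

Lemma card_fano_set8 : #|[set V : {set 'I_16} | fano_set V & inord 8 \in V]| = 7%N.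
Proof.
have -> : [set V : {set 'I_16} | fano_set V & inord 8 \in V] = [set V in map oct_double Otrips].
  apply/setP => V; rewrite !in_set; apply/andP/mapP => [[fanoV V8]|[t tO ->]].
    exact: fano_set8_double.
  by rewrite fano_oct_double // in_set inordK // !in_cons eqxx !orbT.
rewrite cardsE; apply/card_uniqP.
by rewrite map_inj_in_uniq //; apply: oct_double_inj.
Qed.

Local Close Scope ring_scope.

Theorem mainTheorem6 (R : realType) :
  (forall V : {set 'I_16}, fano_set V ->
     [/\ flowmorphic (sed_unit R) V <-> ~ harbors_zero_divisors R V,
         flowmorphic (sed_unit R) V <-> (V = oct_set \/ inord 8 \in V) &
         harbors_zero_divisors R V ->
           forall N : {set 'I_16}, N \subset V -> ~ flowmorphic (neg_units R N) V])
  /\ fano_set oct_set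
  /\ #|[set V : {set 'I_16} | fano_set V & inord 8 \in V]| = 7.
Proof.
split; last by split; [exact: fano_oct_set|exact: card_fano_set8].
move=> V fanoV; have V_not0 := fano_set_notin0 fanoV.
have flow_nzd : flowmorphic (sed_unit R) V -> ~ harbors_zero_divisors R V.
  by move/flowmorphic_neg_units0; apply: flowmorphic_no_zero_divisors; rewrite ?sub0set.
have oct_flow : V = oct_set \/ inord 8 \in V -> flowmorphic (sed_unit R) V.
  case=> [->|/(fano_set8_double fanoV)[t tO ->]]; first exact: oct_set_flowmorphic.
  exact: oct_double_flowmorphic.
have nzd_oct : ~ harbors_zero_divisors R V -> V = oct_set \/ inord 8 \in V.
  move=> nzd; have [->|V_oct] := eqVneq V oct_set; first by left.
  by right; apply/negPn/negP => V8; apply/nzd/fano_set_zero_divisors.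
split; first by split=> // /nzd_oct.
  by split=> // /flow_nzd.
by move=> zd N NV /(flowmorphic_no_zero_divisors V_not0 NV).
Qed.
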